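(* Let $A\in\mathcal{B}(\mathcal{H})$ be a positive operator with $\dim(R(A))\ge 2$, and let $q\in\mathcal{D}$. Then: (i) $|q|\,w_A(T)\le w_{q,A}(T)$ for every $T\in\mathcal{B}_{A^{1/2}}(\mathcal{H})$; (ii) $\frac{|q|}{2}\|T\|_A\le w_{q,A}(T)\le \|T\|_A$ for every $T\in\mathcal{B}_A(\mathcal{H})$; (iii) if $T\in\mathcal{B}_A(\mathcal{H})$ is $A$-self-adjoint, then $|q|\,w_A(T)\le w_{q,A}(T)\le w_A(T)$, equivalently $|q|\,\|T\|_A\le w_{q,A}(T)\le\|T\|_A$.
   Context: $\mathcal{H}$ is a separable infinite-dimensional complex Hilbert space with inner product $\langle\cdot,\cdot\rangle$ (linear in the first variable); $\mathcal{B}(\mathcal{H})$ is the algebra of bounded linear operators on $\mathcal{H}$; $R(A)$ is the range of $A$. $A$ positive means $\langle Ax,x\rangle\ge 0$ for all $x$. Put $\langle x,y\rangle_A=\langle Ax,y\rangle$ and $\|x\|_A=\sqrt{\langle x,x\rangle_A}$. $\mathcal{D}=\{z\in\mathbb{C}:|z|\le 1\}$. $\mathcal{B}_{A^{1/2}}(\mathcal{H})=\{T\in\mathcal{B}(\mathcal{H}):\exists c>0,\ \|Tx\|_A\le c\|x\|_A\ \forall x\in\mathcal{H}\}$, and $\mathcal{B}_A(\mathcal{H})=\{T\in\mathcal{B}(\mathcal{H}):R(T^*A)\subseteq R(A)\}\subseteq\mathcal{B}_{A^{1/2}}(\mathcal{H})$. For $T\in\mathcal{B}_{A^{1/2}}(\mathcal{H})$,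 $\|T\|_A=\sup\{\|Tx\|_A/\|x\|_A: x\in\overline{R(A)},\ x\ne 0\}$. $T$ is $A$-self-adjoint if $AT=T^*A$. The $A$-$q$-numerical range is $W_{q,A}(T)=\{\langle Tx,y\rangle_A: x,y\in\mathcal{H},\ \|x\|_A=\|y\|_A=1,\ \langle x,y\rangle_A=q\}$ and the $A$-$q$-numerical radius is $w_{q,A}(T)=\sup\{|\lambda|:\lambda\in W_{q,A}(T)\}$. The $A$-numerical radius is $w_A(T)=\sup\{|\langle Tx,x\rangle_A|: x\in\mathcal{H},\ \|x\|_A=1\}$. *)

(* Defs.v *)
From HB Require Import structures.
From mathcomp Require Import all_boot all_order all_algebra.
From mathcomp Require Export complex.
From mathcomp Require Import boolp classical_sets functions cardinality.
From mathcomp Require Import reals ereal topology normedtype.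

Set Implicit Arguments.
Unset Strict Implicit.
Unset Printing Implicit Defensive.

Import Order.TTheory GRing.Theory Num.Theory.
Import numFieldNormedType.Exports.

Local Open Scope classical_set_scope.
Local Open Scope ring_scope.
Local Open Scope complex_scope.

(* The modulus of a complex number as an element of R; the norm `|z| of R[i]
   takes its values in R[i]. *)
Notation cmod := ComplexField.Normc.normc.

(* A Hilbert space is a complete normed module over R[i] together with a
   positive definite Hermitian form ip (linear in its first argument) that
   induces the norm: see [induces_norm]. *)
Section HilbertSpace.
Variables (R : realType) (H : completeNormedModType R[i]).

Definition induces_norm (ip : {dot H for Num.conj}) : Prop :=
  forall x : H, `|x| ^+ 2 = ip x x.

Definition separable : Prop := exists2 S : set H, countable S & dense S.

(* For a linear subspace S, dim_ge n S says that n <= dim S. *)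
Definition dim_ge (n : nat) (S : set H) : Prop :=
  exists2 v : 'I_n -> H, (forall i, S (v i)) &
    forall c : 'I_n -> R[i], \sum_(i < n) c i *: v i = 0 -> forall i, c i = 0.

Definition infinite_dimensional : Prop := forall n, dim_ge n [set: H].

Definition bounded_op (T : H -> H) : Prop :=
  exists c : R, forall x, `|T x| <= c%:C * `|x|.

Variable ip : {dot H for Num.conj}.

(* For a bounded linear T the set below is a singleton by the Riesz
   representation theorem, so the default value 0 is never used. *)
Definition adjoint (T : H -> H) (y : H) : H :=
  xget 0 [set z | forall x, ip (T x) y = ip x z].

(* In the order of R[i], 0 <= z means that z is real and nonnegative. *)
Definition positive_op (A : H -> H) : Prop := forall x, 0 <= ip (A x) x.

Variable A : H -> H.

Definition ipA (x y : H) : R[i] := ip (A x) y.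

(* ipA x x is real when A is positive, so Re only changes its type. *)
Definition normA (x : H) : R := Num.sqrt (complex.Re (ipA x x)).

Definition B_Ahalf (T : H -> H) : Prop :=
  bounded_op T /\ exists2 c : R, 0 < c & forall x, normA (T x) <= c * normA x.

Definition B_A (T : H -> H) : Prop :=
  bounded_op T /\ range (adjoint T \o A) `<=` range A.

Definition A_selfadjoint (T : H -> H) : Prop :=
  forall x, A (T x) = adjoint T (A x).

(* All suprema are taken in the extended reals \bar R, so that no boundedness
   is presupposed. *)

Definition opnormA (T : H -> H) : \bar R :=
  ereal_sup [set (normA (T x) / normA x)%:E |
             x in [set x | closure (range A) x /\ x <> 0]].

Definition W_A (q : R[i]) (T : H -> H) : set R[i] :=
  [set z | exists x y, [/\ normA x = 1, normA y = 1, ipA x y = q &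
                           z = ipA (T x) y]].

Definition wq_A (q : R[i]) (T : H -> H) : \bar R :=
  ereal_sup [set (cmod z)%:E | z in W_A q T].

Definition w_A (T : H -> H) : \bar R :=
  ereal_sup [set (cmod (ipA (T x) x))%:E | x in [set x | normA x = 1]].

End HilbertSpace.

(* Main.v *)
Require Import Defs.
From HB Require Import structures.
From mathcomp Require Import all_boot all_order all_algebra.
From mathcomp Require Import boolp classical_sets functions cardinality.
From mathcomp Require Import reals ereal topology normedtype.
From mathcomp Require Import ring lra.

Set Implicit Arguments.
Unset Strict Implicit.
Unset Printing Implicit Defensive.

Import Order.TTheory GRing.Theory Num.Theory.
Import numFieldNormedType.Exports.

Local Open Scope classical_set_scope.
Local Open Scope ring_scope.
Local Open Scope complex_scope.

(** Everything takes place in the semi-inner product <x, y>_A = <A x, y>, which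
obeys the Cauchy-Schwarz inequality and the parallelogram law like any other.

Part (i). Given an A-unit vector x, the assumption dim R(A) >= 2 provides an
A-unit vector z that is A-orthogonal to x ([exists_orthogonal_unitA]). For
either sign, y = q^* x +- sqrt(1 - |q|^2) z is an A-unit vector with
<x, y>_A = q, and <T x, y>_A = q <T x, x>_A +- sqrt(1 - |q|^2) <T x, z>_A. For
one of the signs the modulus is at least |q| |<T x, x>_A|
([prescribed_product]).

Part (ii), lower bound. Polarization and the parallelogram law give
|<T x, y>_A| <= 2 w_A(T) for A-unit vectors ([bilinear_bound]), hence
||T||_A <= 2 w_A(T), and part (i) applies.

Part (ii), upper bound. By Cauchy-Schwarz it suffices that the bound defining
||T||_A, which is known on R(A), holds on all of H. Two facts extend it.
Every x is a limit, in the A-seminorm, of elements of R(A): iterating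
u |-> u - A u / c from x stays in x + R(A) and makes the A-seminorm small
([range_dense]). And R(T^* A) included in R(A) means that each y has some w with
<T x, y>_A = <x, w>_A for all x ([B_A_adjoint]), so that the left-hand side is
continuous in x for the A-seminorm. The latter uses the true adjoint of T, whose
existence is the Riesz representation theorem ([riesz]); it is proved by
minimising |x|^2 - 2 Re F(x).

Part (iii). If T is A-self-adjoint, the form <T x, y>_A is Hermitian, and after
rotating x so that <T x, y>_A is a nonnegative real, polarization bounds it by
w_A(T) without the factor 2 ([symmetric_bound]). This gives both
w_{q,A}(T) <= w_A(T) and ||T||_A <= w_A(T). *)

(** * Complex moduli *)

Section ComplexModulus.
Variable R : realType.
Implicit Types z w : R[i].

Lemma cmodE z : `|z| = (cmod z)%:C.
Proof. by []. Qed.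

Lemma cmod_ge0 z : 0 <= cmod z.
Proof. by rewrite -ler0c -cmodE. Qed.

Lemma conjcD z w : conjc (z + w) = conjc z + conjc w.
Proof. exact: rmorphD. Qed.

Lemma conjcM z w : conjc (z * w) = conjc z * conjc w.
Proof. exact: rmorphM. Qed.

Lemma conjcN z : conjc (- z) = - conjc z.
Proof. exact: rmorphN. Qed.

Lemma realcM (r s : R) : (r * s)%:C = r%:C * s%:C.
Proof. exact: rmorphM. Qed.

Lemma realcX (r : R) n : (r ^+ n)%:C = r%:C ^+ n.
Proof. exact: rmorphXn. Qed.

Lemma cmodJ z : cmod (conjc z) = cmod z.
Proof. by apply: complexI; rewrite -!cmodE normcJ. Qed.

Lemma cmodR (r : R) : 0 <= r -> cmod r%:C = r.
Proof. by move=> r0; apply: complexI; rewrite -cmodE ger0_norm// ler0c. Qed.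

Lemma sqr_cmodR (r : R) : cmod r%:C ^+ 2 = r ^+ 2.
Proof.
by apply: complexI; rewrite realcX -cmodE sqr_normc conjc_real -realcM.
Qed.

Lemma Re_le_cmod z : complex.Re z <= cmod z.
Proof.
by rewrite -lecR -cmodE (le_trans _ (normc_ge_Re z))// lecR ler_norm.
Qed.

Lemma rotate_to_cmod z : exists2 u : R[i], cmod u = 1 & u * z = (cmod z)%:C.
Proof.
have [->|z0] := eqVneq z 0.
  exists 1; first exact: ComplexField.Normc.normc1.
  by rewrite mulr0 ComplexField.Normc.normc0.
have nz0 : `|z| != 0 by rewrite normr_eq0.
exists (conjc z / `|z|).
  apply: complexI; rewrite -cmodE normrM normfV normr_id normcJ.
  by rewrite mulfV.
by rewrite mulrAC [conjc z * z]mulrC -sqr_normc expr2 mulfK.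
Qed.

Lemma ReM_real (r : R) z : complex.Re (r%:C * z) = r * complex.Re z.
Proof. by case: z => a b /=; ring. Qed.

End ComplexModulus.

(** * Semi-inner products *)

Record semi_inner (R : realType) (V : lmodType R[i]) (f : V -> V -> R[i]) :
    Prop := SemiInner {
  siDl : forall x y z, f (x + y) z = f x z + f y z;
  siZl : forall a x z, f (a *: x) z = a * f x z;
  siC : forall x y, f y x = conjc (f x y);
  si_ge0 : forall x, 0 <= f x x }.

(** At the form [ipA ip A] this is [normA ip A] by conversion. *)
Definition seminorm (R : realType) (V : lmodType R[i]) (f : V -> V -> R[i])
  (x : V) : R := Num.sqrt (complex.Re (f x x)).

Section SemiInnerProduct.
Variables (R : realType) (V : lmodType R[i]) (f : V -> V -> R[i]).
Hypothesis fP : semi_inner f.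
Local Notation N := (seminorm f).
Local Notation Re := complex.Re.

Lemma siDr x y z : f x (y + z) = f x y + f x z.
Proof. by rewrite (siC fP) siDl// conjcD -!(siC fP). Qed.

Lemma siZr a x y : f x (a *: y) = conjc a * f x y.
Proof. by rewrite (siC fP) siZl// conjcM -(siC fP). Qed.

Lemma siNl x y : f (- x) y = - f x y.
Proof. by rewrite -scaleN1r siZl// mulN1r. Qed.

Lemma siNr x y : f x (- y) = - f x y.
Proof. by rewrite (siC fP) siNl conjcN -(siC fP). Qed.

Lemma siBl x y z : f (x - y) z = f x z - f y z.
Proof. by rewrite siDl// siNl. Qed.

Lemma siBr x y z : f x (y - z) = f x y - f x z.
Proof. by rewrite siDr siNr. Qed.

Lemma si_ReC x y : Re (f y x) = Re (f x y).
Proof. by rewrite (siC fP); case: (f x y). Qed.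

Lemma seminorm_ge0 x : 0 <= N x.
Proof. exact: sqrtr_ge0. Qed.

Lemma si_real x : f x x = (Re (f x x))%:C.
Proof. by rewrite RRe_real// ger0_real// si_ge0. Qed.

Lemma sqr_seminorm x : N x ^+ 2 = Re (f x x).
Proof. by rewrite sqr_sqrtr// -ler0c -si_real si_ge0. Qed.

Lemma si_seminorm x : f x x = (N x ^+ 2)%:C.
Proof. by rewrite sqr_seminorm -si_real. Qed.

Lemma seminormZ a x : N (a *: x) = cmod a * N x.
Proof.
apply/eqP; rewrite -(@eqrXn2 _ 2)//; last 2 first.
- exact: seminorm_ge0.
- by rewrite mulr_ge0 ?cmod_ge0 ?seminorm_ge0.
apply/eqP/complexI; rewrite -si_seminorm siZl// siZr mulrA -sqr_normc.
by rewrite si_seminorm cmodE -realcX -realcM exprMn.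
Qed.

Lemma seminorm0 : N 0 = 0.
Proof. by rewrite -(scale0r 0) seminormZ ComplexField.Normc.normc0 mul0r. Qed.

Lemma seminormN x : N (- x) = N x.
Proof. by rewrite /seminorm siNl siNr opprK. Qed.

Lemma sqr_seminormD x y :
  N (x + y) ^+ 2 = N x ^+ 2 + N y ^+ 2 + 2 * Re (f x y).
Proof.
rewrite !sqr_seminorm siDl// !siDr !raddfD/= (si_ReC x y).
by ring.
Qed.

Lemma sqr_seminormB x y :
  N (x - y) ^+ 2 = N x ^+ 2 + N y ^+ 2 - 2 * Re (f x y).
Proof. by rewrite sqr_seminormD seminormN siNr raddfN/= mulrN. Qed.

Lemma parallelogram x y :
  N (x + y) ^+ 2 + N (x - y) ^+ 2 = 2 * (N x ^+ 2 + N y ^+ 2).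
Proof. by rewrite sqr_seminormD sqr_seminormB; ring. Qed.

(** Expand the squared seminorm of |y|^2 x - b y and of b x - |x|^2 y, where b is
the real part of f x y; if both seminorms vanish, that of x - b y forces b = 0. *)
Lemma Re_cauchy_schwarz_si x y : Re (f x y) ^+ 2 <= N x ^+ 2 * N y ^+ 2.
Proof.
set b := Re (f x y).
have comb (s t : R) :
    0 <= s ^+ 2 * N x ^+ 2 + t ^+ 2 * N y ^+ 2 - 2 * (s * t * b).
  have := sqr_ge0 (N (s%:C *: x - t%:C *: y)).
  rewrite sqr_seminormB !seminormZ siZl// siZr conjc_real !ReM_real -/b.
  by rewrite !exprMn !sqr_cmodR !mulrA.
have := comb 1 b; have := comb (N y ^+ 2) b; have := comb b (N x ^+ 2).
have := sqr_ge0 (N x); have := sqr_ge0 (N y).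
move: (N x ^+ 2) (N y ^+ 2) => X Y Y0 X0 c1 c2 c3.
have [Yp|Yn] := ltrP 0 Y.
  have : 0 <= Y * (X * Y - b ^+ 2) by move: c2; congr (0 <= _); ring.
  by rewrite pmulr_rge0// subr_ge0.
have [Xp|Xn] := ltrP 0 X.
  have : 0 <= X * (X * Y - b ^+ 2) by move: c1; congr (0 <= _); ring.
  by rewrite pmulr_rge0// subr_ge0.
have X_0 : X = 0 by apply/eqP; rewrite eq_le Xn X0.
have Y_0 : Y = 0 by apply/eqP; rewrite eq_le Yn Y0.
by rewrite X_0 Y_0 in c3 *; nra.
Qed.

(** A rotation of x makes f x y real. *)
Lemma cauchy_schwarz_si x y : cmod (f x y) <= N x * N y.
Proof.
have [u u1 ufxy] := rotate_to_cmod (f x y).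
rewrite -(@ler_pXn2r _ 2)// ?nnegrE ?cmod_ge0 ?mulr_ge0 ?seminorm_ge0//.
have := Re_cauchy_schwarz_si (u *: x) y.
by rewrite siZl// ufxy /= seminormZ u1 mul1r exprMn.
Qed.

Lemma seminormD x y : N (x + y) <= N x + N y.
Proof.
rewrite -(@ler_pXn2r _ 2)// ?nnegrE ?addr_ge0 ?seminorm_ge0//.
rewrite sqr_seminormD.
have := le_trans (Re_le_cmod _) (cauchy_schwarz_si x y).
by rewrite sqrrD -mulr_natl; lra.
Qed.

Lemma seminorm_eq0_orth x y : N x = 0 -> f x y = 0.
Proof.
move=> x0; apply: ComplexField.Normc.eq0_normc; apply/eqP.
by rewrite eq_le cmod_ge0 andbT (le_trans (cauchy_schwarz_si x y))// x0 mul0r.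
Qed.

End SemiInnerProduct.

(** * The Riesz representation theorem *)

Section Riesz.
Variables (R : realType) (H : completeNormedModType R[i]).
Variable ip : {dot H for Num.conj}.
Hypothesis ip_norm : induces_norm ip.
Local Notation N := (seminorm ip).
Local Notation Re := complex.Re.

Lemma dot_semi_inner : semi_inner ip.
Proof.
split.
- by move=> x y z; rewrite linearDl.
- by move=> a x z; rewrite linearZl_LR.
- by move=> x y; rewrite hermC expr0 mul1r.
- by move=> x; exact: dnorm_ge0.
Qed.
Let ipP := dot_semi_inner.

Lemma norm_seminorm x : `|x| = (N x)%:C.
Proof.
apply/eqP; rewrite -(@eqrXn2 _ 2)// ?ler0c ?seminorm_ge0//.
by rewrite ip_norm (si_seminorm ipP) realcX.
Qed.

Lemma le_inv_small (D e : R) :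
  0 <= D -> 0 < e -> exists n : nat, D * n.+1%:R^-1 < e.
Proof.
move=> D0 e0; exists (Num.truncn (D / e)).
rewrite ltr_pdivrMr ?ltr0n// mulrC -ltr_pdivrMr//.
exact: truncnS_gt.
Qed.

Lemma invS_le (m n : nat) : (m <= n)%N -> (n.+1%:R^-1 : R) <= m.+1%:R^-1.
Proof. by move=> mn; rewrite lef_pV2 ?posrE ?ltr0n// ler_nat. Qed.

Lemma sqrD_small (x y X Y a b e : R) :
  0 <= X -> 0 <= Y -> 0 <= a -> x ^+ 2 <= b * X -> b <= a -> y ^+ 2 <= X * Y ->
  a * (4 * X + 1) < e -> Y * (4 * X + 1) < e -> (x + y) ^+ 2 <= e.
Proof.
move=> X0 Y0 a0 xX ab yX aX YX.
have xyE : 2 * x ^+ 2 + 2 * y ^+ 2 - (x + y) ^+ 2 = (x - y) ^+ 2 by ring.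
have := sqr_ge0 (x - y); rewrite -xyE subr_ge0 => /le_trans; apply.
have : b * X <= a * X by exact: ler_wpM2r.
by move: xX yX aX YX; move: (x ^+ 2) (y ^+ 2) => *; lra.
Qed.

Section Minimisation.
Variables (F : H -> R[i]) (c : R).
Hypothesis F_lin : forall a x y, F (a *: x + y) = a * F x + F y.
Hypothesis F_bounded : forall x, cmod (F x) <= c * N x.

(** Equal to |x - z|^2 - |z|^2 if F = ip ^~ z, so that z is its minimiser. *)
Let energy x := N x ^+ 2 - 2 * Re (F x).
Let m := inf (range energy).

Let F0 : F 0 = 0.
Proof.
by have := F_lin (-1) 0 0; rewrite scaler0 addr0 mulN1r addNr.
Qed.

Let FD x y : F (x + y) = F x + F y.
Proof. by rewrite -[x]scale1r F_lin !scale1r mul1r. Qed.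

Let FZ a x : F (a *: x) = a * F x.
Proof. by rewrite -[a *: x]addr0 F_lin F0 addr0. Qed.

Let energy_lbounded : has_lbound (range energy).
Proof.
exists (- c ^+ 2) => _ [x _ <-]; rewrite /energy.
have := le_trans (Re_le_cmod _) (F_bounded x).
have := sqr_ge0 (N x - c).
by rewrite sqrrB -[_ *+ 2]mulr_natl; lra.
Qed.

Let le_energy x : m <= energy x.
Proof. by apply: ge_inf => //; exists x. Qed.

(** The parallelogram law, since the midpoint has energy at least m. *)
Let sqr_dist_energy x y :
  N (x - y) ^+ 2 <= 2 * (energy x - m) + 2 * (energy y - m).
Proof.
have := le_energy ((2^-1)%:C *: (x + y)).
rewrite /energy (seminormZ ipP) cmodR ?invr_ge0// FZ ReM_real FD raddfD/=.
have := parallelogram ipP x y; rewrite exprMn.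
move: (Re (F x)) (Re (F y)) (N x ^+ 2) (N y ^+ 2) (N (x - y) ^+ 2)
  (N (x + y) ^+ 2) m => *; lra.
Qed.

(** Moving from x in the direction h cannot bring the energy below m; the
inequality is the one for the optimal step length d / |h|^2. *)
Let sqr_error_energy x h :
  Re (F h - ip h x) ^+ 2 <= (energy x - m) * N h ^+ 2.
Proof.
set d := Re _.
have step (t : R) : 2 * t * d <= (energy x - m) + t ^+ 2 * N h ^+ 2.
  have := le_energy (x + t%:C *: h).
  rewrite /energy (sqr_seminormD ipP) (seminormZ ipP) (si_ReC ipP) (siZl ipP).
  rewrite FD FZ raddfD/= !ReM_real exprMn sqr_cmodR.
  have -> : d = Re (F h) - Re (ip h x) by rewrite /d raddfB.
  move: (Re (F x)) (Re (F h)) (Re (ip h x)) (N x ^+ 2) (N h ^+ 2) m => *; lra.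
have a0 : 0 <= energy x - m by rewrite subr_ge0.
have h0 := sqr_ge0 (N h).
clearbody d; move: (energy x - m) (N h ^+ 2) step a0 h0 => a X step a0 X0.
have [X1|X1] := ltrP 0 X.
  have Xn := lt0r_neq0 X1.
  have := step (d / X).
  have -> : (d / X) ^+ 2 * X = d ^+ 2 / X by field.
  have -> : 2 * (d / X) * d = 2 * (d ^+ 2 / X) by field.
  by move=> sX; rewrite -ler_pdivrMr//; lra.
have X_0 : X = 0 by apply/eqP; rewrite eq_le X1 X0.
(* If h = 0, a long step in the direction h excludes d <> 0. *)
rewrite X_0 mulr0; have [->|dn] := eqVneq d 0; first by rewrite expr0n.
have := step ((a + 1) / d); rewrite X_0 mulr0.
have -> : 2 * ((a + 1) / d) * d = 2 * (a + 1) by field.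
by lra.
Qed.

(** Minimising sequences of the energy are Cauchy, and along them F - ip ^~ u_n
tends to 0 pointwise, so that their limit represents F. *)
Lemma riesz : exists z, forall x, F x = ip x z.
Proof.
have /boolp.choice[u u_min] : forall n, exists x, energy x - m < n.+1%:R^-1.
  move=> n.
  have n0 : (0 : R) < n.+1%:R^-1 by rewrite invr_gt0 ltr0n.
  have [|_ [x _ <-] xm] := @inf_adherent R (range energy) _ n0.
    by split=> //; exists (energy 0), 0.
  by exists x; rewrite ltrBlDl.
have u_dist k n : (k <= n)%N -> N (u k - u n) ^+ 2 < 4 * k.+1%:R^-1.
  move=> kn; have := sqr_dist_energy (u k) (u n).
  have := u_min k; have := u_min n; have := invS_le kn.
  move: (energy (u k)) (energy (u n)) (N _ ^+ 2) (k.+1%:R^-1) (n.+1%:R^-1) m.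
  by move=> *; lra.
have u_cauchy : cauchy (u @ \oo).
  apply: cauchy_exP => e e0.
  have er : e = (Re e)%:C by rewrite RRe_real// gtr0_real.
  have re0 : 0 < Re e by move: e0; rewrite er ltcR.
  have [k ke] := @le_inv_small 4 _ (ler0n _ _) (exprn_gt0 2 re0).
  exists (u k); exists k => // n /= kn.
  rewrite -ball_normE/= norm_seminorm er ltcR.
  rewrite -(@ltr_pXn2r _ 2)// ?nnegrE ?seminorm_ge0 ?(ltW re0)//.
  exact: lt_trans (u_dist _ _ kn) ke.
have [l u_l] := (cvg_ex _).1 (cauchy_cvg _ u_cauchy).
exists l.
have u_lim (e : R) : 0 < e -> exists n, n.+1%:R^-1 < e /\ N (u n - l) ^+ 2 < e.
  move=> e0; have [k ke] := @le_inv_small 1 _ (ler01) e0.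
  have r0 : 0 < Num.sqrt e by rewrite sqrtr_gt0.
  have [|M _ Mu] := (cvgrPdist_lt _ _).1 u_l (Num.sqrt e)%:C.
    by rewrite ltcR.
  exists (maxn k M); split.
    by rewrite mul1r in ke; apply: le_lt_trans ke; exact/invS_le/leq_maxl.
  have := Mu _ (leq_maxr k M).
  rewrite distrC norm_seminorm ltcR => lt_r.
  by rewrite -(sqr_sqrtr (ltW e0)) ltr_pXn2r// ?nnegrE ?seminorm_ge0// ltW.
have Re0 h : Re (F h - ip h l) = 0.
  apply/eqP; rewrite -sqrf_eq0 eq_le sqr_ge0 andbT.
  apply/ler_addgt0Pr => e e0; rewrite add0r.
  have K0 : 0 < 4 * N h ^+ 2 + 1 by have := sqr_ge0 (N h); lra.
  have [n [n1 n2]] := u_lim _ (divr_gt0 e0 K0).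
  have err := sqr_error_energy (u n) h.
  have := Re_cauchy_schwarz_si ipP h (u n - l).
  have -> : Re (F h - ip h l) = Re (F h - ip h (u n)) + Re (ip h (u n - l)).
    by rewrite (siBr ipP) -raddfD/= addrA subrK.
  move: n1 n2; rewrite !ltr_pdivlMr// => n1 n2 cs.
  apply: sqrD_small (sqr_ge0 (N h)) (sqr_ge0 _) _ err _ cs n1 n2.
    by rewrite invr_ge0.
  exact/ltW/u_min.
move=> x; apply/eqP; rewrite -subr_eq0; apply/eqP.
(* Re ('i * z) = - Im z, so the real parts at x and 'i *: x suffice. *)
move: (Re0 x) (Re0 ('i *: x)); rewrite FZ (siZl ipP) -mulrBr.
case: (F x - ip x l) => a b /= ->.
by rewrite mul0r mul1r sub0r => /eqP; rewrite oppr_eq0 => /eqP ->.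
Qed.

End Minimisation.
End Riesz.

(** * Numerical bounds on bilinear values *)

Section Numerical.
Variables (R : realType) (V : lmodType R[i]) (f : V -> V -> R[i]).
Hypothesis fP : semi_inner f.
Variable T : {linear V -> V}.
Local Notation N := (seminorm f).
Local Notation Re := complex.Re.

Section Bound.
Variable w : R.
Hypothesis w_bound : forall u, N u = 1 -> cmod (f (T u) u) <= w.

Lemma quadratic_bound u : cmod (f (T u) u) <= w * N u ^+ 2.
Proof.
have [u0|un] := eqVneq (N u) 0.
  by rewrite (siC fP) (seminorm_eq0_orth fP)// u0 cmodJ ComplexField.Normc.normc0
    expr0n mulr0.
have up : 0 < N u by rewrite lt0r un seminorm_ge0.
have upV : 0 <= (N u)^-1 by rewrite invr_ge0 ltW.
have := w_bound (u := (N u)^-1%:C *: u).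
rewrite (seminormZ fP) cmodR// mulVf// => /(_ erefl).
rewrite linearZ/= (siZl fP) (siZr fP) conjc_real mulrA -realcM.
rewrite ComplexField.Normc.normcM cmodR; last exact: mulr_ge0.
by rewrite -invfM mulrC -expr2 ler_pdivrMr// exprn_gt0.
Qed.

(** The sum is half the difference of the quadratic values at x + y and x - y,
whose squared seminorms add up by the parallelogram law. *)
Lemma polarization_bound x y :
  cmod (f (T x) y + f (T y) x) <= w * (N x ^+ 2 + N y ^+ 2).
Proof.
have pol : (f (T x) y + f (T y) x) *+ 2 =
    f (T (x + y)) (x + y) - f (T (x - y)) (x - y).
  rewrite !(linearD, linearN)/= !(siDl fP, siDr fP, siNl fP, siNr fP).
  by rewrite mulr2n; ring.
have := le_normcD (f (T (x + y)) (x + y)) (- f (T (x - y)) (x - y)).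
rewrite -pol normcN normcMn.
have := quadratic_bound (x + y); have := quadratic_bound (x - y).
have := congr1 ( *%R w) (parallelogram fP x y); rewrite mulrDr -mulr_natl.
by move=> *; lra.
Qed.

(** Polarization bounds the sum of f (T x) y and f (T y) x and, with 'i y in place
of y, their difference. *)
Lemma bilinear_bound x y : N x = 1 -> N y = 1 -> cmod (f (T x) y) <= 2 * w.
Proof.
move=> x1 y1; have i1 : cmod ('i : R[i]) = 1.
  by rewrite /= expr0n expr1n add0r sqrtr1.
have := polarization_bound x y.
have := polarization_bound x ('i *: y).
rewrite (seminormZ fP) i1 mul1r x1 y1 linearZ/= (siZl fP) (siZr fP) expr1n.
have -> : conjc ('i : R[i]) = - 'i.
  by apply/eqP; rewrite eq_complex /= oppr0 !eqxx.
rewrite mulNr addrC -mulrBr ComplexField.Normc.normcM i1 mul1r => b1 b2.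
have := le_normcD (f (T x) y + f (T y) x) (- (f (T y) x - f (T x) y)).
rewrite normcN.
have -> : f (T x) y + f (T y) x - (f (T y) x - f (T x) y) = f (T x) y *+ 2.
  by rewrite mulr2n; ring.
by rewrite normcMn -mulr_natl => b3; lra.
Qed.

(** For symmetric T, polarization bounds twice the real part of f (T x) y; rotating
x makes this real part the modulus. *)
Lemma symmetric_bound : (forall x y, f (T x) y = f x (T y)) ->
  forall x y, N x = 1 -> N y = 1 -> cmod (f (T x) y) <= w.
Proof.
move=> T_sym x y x1 y1; have [u u1 uE] := rotate_to_cmod (f (T x) y).
have := polarization_bound (u *: x) y.
rewrite (seminormZ fP) u1 x1 y1 mul1r expr1n.
have -> : f (T (u *: x)) y = (cmod (f (T x) y))%:C.
  by rewrite linearZ/= (siZl fP) uE.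
have -> : f (T y) (u *: x) = (cmod (f (T x) y))%:C.
  rewrite (siC fP) -T_sym linearZ/= (siZl fP) uE.
  exact: conjc_real.
rewrite -mulr2n normcMn cmodR ?cmod_ge0// -mulr_natl.
by move=> *; lra.
Qed.

End Bound.

(** Take y to be the normalisation of T x; if |x| or |T x| is zero, so is the
ratio. *)
Lemma seminorm_ratio_bound (M : R) : 0 <= M ->
  (forall x y, N x = 1 -> N y = 1 -> cmod (f (T x) y) <= M) ->
  forall x, N (T x) / N x <= M.
Proof.
move=> M0 bM x.
have [->|xn] := eqVneq (N x) 0; first by rewrite invr0 mulr0.
have [->|Txn] := eqVneq (N (T x)) 0; first by rewrite mul0r.
have xV : 0 <= (N x)^-1 by rewrite invr_ge0 seminorm_ge0.
have TxV : 0 <= (N (T x))^-1 by rewrite invr_ge0 seminorm_ge0.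
have := bM ((N x)^-1%:C *: x) ((N (T x))^-1%:C *: T x).
rewrite !(seminormZ fP) !cmodR// !mulVf// => /(_ erefl erefl).
rewrite linearZ/= (siZl fP) (siZr fP) conjc_real (si_seminorm fP) -!realcM.
rewrite cmodR; last by do 2 apply: mulr_ge0 => //; exact: sqr_ge0.
by rewrite expr2 mulKf// mulrC.
Qed.

Section PrescribedProduct.
Variable q : R[i].
Hypothesis q_le1 : cmod q <= 1.

(** Both y = q^* x +- s z, with s = sqrt (1 - |q|^2), have the prescribed product,
and f (T x) y = a +- b with a = q f (T x) x. One of |a + b| and |a - b| is at
least |a|. *)
Lemma prescribed_product x z : N x = 1 -> N z = 1 -> f x z = 0 ->
  exists y, [/\ N y = 1, f x y = q &
    cmod q * cmod (f (T x) x) <= cmod (f (T x) y)].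
Proof.
move=> x1 z1 xz.
have s0 : 0 <= 1 - cmod q ^+ 2.
  by rewrite subr_ge0 exprn_ile1 ?cmod_ge0.
set s := Num.sqrt (1 - cmod q ^+ 2).
have ys (e : R) : e ^+ 2 = 1 -> let y := conjc q *: x + (e * s)%:C *: z in
    N y = 1 /\ f x y = q.
  move=> e1 y; split.
    apply/eqP; rewrite -sqrp_eq1 ?seminorm_ge0//; apply/eqP.
    rewrite /y (sqr_seminormD fP) !(seminormZ fP) (siZl fP) (siZr fP).
    rewrite xz !mulr0 x1 z1 !mulr1 cmodJ addr0.
    suff -> : cmod (e * s)%:C ^+ 2 = 1 - cmod q ^+ 2 by rewrite addrC subrK.
    by rewrite sqr_cmodR exprMn e1 mul1r sqr_sqrtr.
  rewrite /y (siDr fP) !(siZr fP) xz mulr0 addr0 conjcK.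
  by rewrite (si_seminorm fP) x1 expr1n mulr1.
have [|yp1 yp2] := ys 1; first by rewrite expr1n.
have [|ym1 ym2] := ys (-1); first by rewrite sqrrN expr1n.
rewrite mulN1r mul1r in yp1 yp2 ym1 ym2.
rewrite -ComplexField.Normc.normcM.
set a := q * _.
set b := s%:C * f (T x) z.
have ypE : f (T x) (conjc q *: x + s%:C *: z) = a + b.
  by rewrite (siDr fP) !(siZr fP) conjcK conjc_real.
have ymE : f (T x) (conjc q *: x + (- s)%:C *: z) = a - b.
  rewrite (siDr fP) !(siZr fP) conjcK conjc_real -mulNr; congr (_ + _ * _).
  by rewrite -!complexr0 /=; apply/eqP; rewrite eq_complex/= oppr0 !eqxx.
have : 2 * cmod a <= cmod (a + b) + cmod (a - b).
  have := le_normcD (a + b) (a - b).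
  by rewrite addrACA subrr addr0 -mulr2n normcMn mulr_natl.
have [le_ab _|lt_ab] := lerP (cmod a) (cmod (a + b)).
  by exists (conjc q *: x + s%:C *: z); rewrite ypE.
move=> le_2a; exists (conjc q *: x + (- s)%:C *: z); rewrite ymE; split=> //.
by lra.
Qed.

End PrescribedProduct.
End Numerical.

(** * The form of a positive operator *)

Section OperatorForm.
Variables (R : realType) (H : completeNormedModType R[i]).
Variable ip : {dot H for Num.conj}.
Hypothesis ip_norm : induces_norm ip.
Local Notation N := (seminorm ip).
Local Notation Re := complex.Re.
Local Notation Im := complex.Im.
Let ipP := dot_semi_inner ip.

Lemma bounded_op_seminorm (T : H -> H) : bounded_op T ->
  exists2 c : R, 0 < c & forall x, N (T x) <= c * N x.
Proof.
move=> [c cT]; exists (`|c| + 1); first by rewrite ltr_wpDl.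
move=> x; have := cT x; rewrite !(norm_seminorm ip_norm) -realcM lecR.
move=> /le_trans; apply; apply: ler_wpM2r; first exact: seminorm_ge0.
by rewrite (le_trans (ler_norm c))// lerDl.
Qed.

Lemma adjointP (T : {linear H -> H}) : bounded_op T ->
  forall x y, ip (T x) y = ip x (adjoint ip T y).
Proof.
move=> /bounded_op_seminorm[c c0 cT] x y.
have [||z zP] := @riesz _ _ _ ip_norm (fun x => ip (T x) y) (c * N y).
- by move=> a u v; rewrite linearP/= (siDl ipP) (siZl ipP).
- move=> u; rewrite (le_trans (cauchy_schwarz_si ipP _ _))// mulrAC.
  by rewrite ler_wpM2r ?seminorm_ge0.
by rewrite /adjoint; case: xgetP => [w -> /(_ x)|/(_ z)].
Qed.

Variable A : {linear H -> H}.
Hypothesis A_bounded : bounded_op A.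
Hypothesis A_pos : positive_op ip A.
Local Notation fA := (ipA ip A).
Local Notation NA := (seminorm fA).

(** Polarization: a sesquilinear form with real diagonal is Hermitian. *)
Lemma ipA_semi_inner : semi_inner fA.
Proof.
have Dl x y z : fA (x + y) z = fA x z + fA y z.
  by rewrite /ipA linearD/= (siDl ipP).
have Zl a x z : fA (a *: x) z = a * fA x z.
  by rewrite /ipA linearZ/= (siZl ipP).
split=> // x y.
have Im0 u : Im (fA u u) = 0 by exact/ger0_Im/A_pos.
have Dr u v w : fA u (v + w) = fA u v + fA u w by rewrite /ipA (siDr ipP).
have Zr a u v : fA u (a *: v) = conjc a * fA u v by rewrite /ipA (siZr ipP).
have := Im0 (x + 'i *: y); have := Im0 (x + y).
rewrite !(Dl, Dr, Zl, Zr).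
move: (Im0 x) (Im0 y); case: (fA x x) (fA y y) (fA x y) (fA y x).
move=> a1 b1 [a2 b2] [a3 b3] [a4 b4] /= -> -> h1 h2.
by apply/eqP; rewrite eq_complex/=; apply/andP; split; apply/eqP; lra.
Qed.
Let fAP := ipA_semi_inner.

Lemma ipA_sym u v : fA u v = ip u (A v).
Proof. by rewrite (siC fAP) /ipA (siC ipP) conjcK. Qed.

Lemma seminormA_eq0 x : NA x = 0 -> A x = 0.
Proof.
move=> x0; apply/eqP; rewrite -(dnorm_eq0 ip).
by rewrite -[ip _ _]/(fA x (A x)) (seminorm_eq0_orth fAP).
Qed.

(** A gradient step for the quadratic form of A. The cross term contributes
- 2 |u|_A^2 / c, and |A u|^2 <= c |u|_A^2, by Cauchy-Schwarz for the form of A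
applied to u and A u, gives back at most half of it. *)
Lemma sqr_seminorm_step (c : R) u : 0 < c -> (forall x, N (A x) <= c * N x) ->
  N (u - c^-1%:C *: A u) ^+ 2 <= N u ^+ 2 - NA u ^+ 2 / c.
Proof.
move=> c0 cA.
have le1 : N (A u) ^+ 2 <= c * NA u ^+ 2.
  have [->|Aun] := eqVneq (N (A u)) 0.
    by rewrite expr0n mulr_ge0 ?sqr_ge0// ltW.
  have Aup : 0 < N (A u) ^+ 2 by rewrite exprn_gt0// lt0r Aun seminorm_ge0.
  have : N (A u) ^+ 2 <= NA u * NA (A u).
    have := cauchy_schwarz_si fAP u (A u).
    by rewrite /ipA (si_seminorm ipP) cmodR// sqr_ge0.
  move=> /(lerXn2r 2); rewrite !nnegrE sqr_ge0 mulr_ge0 ?seminorm_ge0//.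
  move=> /(_ isT isT); rewrite [(NA _ * _) ^+ 2]exprMn.
  have : NA (A u) ^+ 2 <= c * N (A u) ^+ 2.
    rewrite (sqr_seminorm fAP) (le_trans (Re_le_cmod _))//.
    rewrite (le_trans (cauchy_schwarz_si ipP _ _))// expr2 mulrA.
    by rewrite ler_wpM2r ?seminorm_ge0.
  have := sqr_ge0 (NA u).
  move: (N (A u) ^+ 2) (NA u ^+ 2) (NA (A u) ^+ 2) Aup => X Y Z X0 Y0 ZX XX.
  rewrite -(ler_pM2r X0) -expr2 (le_trans XX)// [c * Y]mulrC -mulrA.
  exact: ler_wpM2l.
rewrite (sqr_seminormB ipP) (seminormZ ipP) cmodR ?invr_ge0 ?(ltW c0)//.
rewrite (siZr ipP) conjc_real ReM_real exprMn.
have -> : Re (ip u (A u)) = NA u ^+ 2.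
  by rewrite (sqr_seminorm fAP) (si_ReC ipP).
have cn := lt0r_neq0 c0.
have : c^-1 ^+ 2 * N (A u) ^+ 2 <= c^-1 ^+ 2 * (c * NA u ^+ 2).
  by rewrite ler_wpM2l// sqr_ge0.
have -> : c^-1 ^+ 2 * (c * NA u ^+ 2) = NA u ^+ 2 / c by field.
rewrite [c^-1 * NA u ^+ 2]mulrC.
by move: (_ / c) (_ * N (A u) ^+ 2) (N u ^+ 2) => *; lra.
Qed.

(** Each gradient step stays in the class of x modulo the range of A and lowers
the squared norm by at least the squared A-seminorm divided by c, so these
A-seminorms are summable and get arbitrarily small. *)
Lemma range_dense x (e : R) : 0 < e -> exists w, NA (x - A w) < e.
Proof.
move=> e0; have [c c0 cA] := bounded_op_seminorm A_bounded.
apply: contrapT => /forallNP far.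
pose u n := iter n (fun u => u - c^-1%:C *: A u) x.
have u_coset n : exists w, u n = x - A w.
  elim: n => [|n [w un]]; first by exists 0; rewrite linear0 subr0.
  by exists (w + c^-1%:C *: u n); rewrite linearD linearZ/= opprD addrA -un.
have uNA n : e ^+ 2 <= NA (u n) ^+ 2.
  have [w ->] := u_coset n; have /negP := far w; rewrite -leNgt => ew.
  by rewrite ler_pXn2r// ?nnegrE ?seminorm_ge0// ltW.
have uN n : N (u n) ^+ 2 <= N x ^+ 2 - n%:R * (e ^+ 2 / c).
  elim: n => [|n IH]; first by rewrite mul0r subr0.
  rewrite [u _]/u iterS -/(u n) (le_trans (sqr_seminorm_step _ c0 cA))//.
  have : e ^+ 2 / c <= NA (u n) ^+ 2 / c.
    by rewrite ler_wpM2r ?invr_ge0 ?(ltW c0).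
  by rewrite -natr1 mulrDl mul1r; move: IH; move: (_ / c) (NA _ ^+ 2 / c) => *; lra.
have d0 : 0 < e ^+ 2 / c by rewrite divr_gt0 ?exprn_gt0.
have := uN (Num.truncn (N x ^+ 2 / (e ^+ 2 / c))).+1.
rewrite leNgt => /negP; apply.
rewrite (lt_le_trans _ (sqr_ge0 _))// subr_lt0 -ltr_pdivrMr//.
exact: truncnS_gt.
Qed.

(** Choose w with T^* A y = A w; then <T x, A y> = <x, T^* A y> = <x, A w>. *)
Lemma B_A_adjoint (T : {linear H -> H}) : B_A ip A T ->
  forall y, exists w, forall x, fA (T x) y = fA x w.
Proof.
move=> [T_bounded T_range] y.
have [w _ Aw] := T_range (adjoint ip T (A y)) (ex_intro2 _ _ y I erefl).
by exists w => x; rewrite !ipA_sym Aw adjointP.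
Qed.

Lemma A_selfadjoint_sym (T : {linear H -> H}) : bounded_op T ->
  A_selfadjoint ip A T -> forall x y, fA (T x) y = fA x (T y).
Proof.
move=> T_bounded T_sa x y.
by rewrite !ipA_sym T_sa -adjointP.
Qed.

(** A bound of T on the range of A passes to all of H: by density it passes to
the pairing with y, whose dependence on x is continuous for the A-seminorm. *)
Lemma extend_range_bound (T : {linear H -> H}) (M : R) : B_A ip A T ->
  0 <= M -> (forall v, NA (T (A v)) <= M * NA (A v)) ->
  forall x y, NA x = 1 -> NA y = 1 -> cmod (fA (T x) y) <= M.
Proof.
move=> T_BA M0 bM x y x1 y1; have [w wP] := B_A_adjoint T_BA y.
have K0 : 0 < M + NA w + 1 by rewrite ltr_wpDl// addr_ge0// seminorm_ge0.
apply/ler_addgt0Pr => e e0.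
have [v vx] := range_dense x (divr_gt0 e0 K0).
have -> : fA (T x) y = fA (T (A v)) y + fA (x - A v) w.
  by rewrite !wP (siBl fAP) addrC subrK.
rewrite (le_trans (le_normcD _ _))//.
have := le_trans (cauchy_schwarz_si fAP (T (A v)) y)
  (ler_wpM2r (seminorm_ge0 fA y) (bM v)).
rewrite y1 mulr1.
have := cauchy_schwarz_si fAP (x - A v) w.
have : NA (A v) <= 1 + NA (x - A v).
  have := seminormD fAP x (- (x - A v)).
  by rewrite (seminormN fAP) x1 opprB addrC subrK.
move: vx; rewrite ltr_pdivlMr//.
have := seminorm_ge0 fA (x - A v); have := seminorm_ge0 fA w.
move: (cmod _) (cmod _) (NA (x - A v)) (NA (A v)) (NA w) => a b d v' w'.
move=> w0 d0 de v1 bd av.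
have : M * v' <= M * (1 + d) by rewrite ler_wpM2l.
by nra.
Qed.

(** * Consequences of dim R(A) >= 2 *)

Section Dimension.
Hypothesis A_dim : dim_ge 2 (range A).

Lemma dim_range_free : exists u v : H,
  forall a b, a *: A u + b *: A v = 0 -> a = 0 /\ b = 0.
Proof.
have [v v_range v_free] := A_dim.
have [u0 _ u0E] := v_range ord0; have [u1 _ u1E] := v_range (lift ord0 ord0).
exists u0, u1 => a b; rewrite u0E u1E => ab0.
have := v_free (fun i => if i == ord0 then a else b).
rewrite !big_ord_recl big_ord0 addr0/= => /(_ ab0) c0.
by split; [have := c0 ord0 | have := c0 (lift ord0 ord0)].
Qed.

Lemma exists_image_neq0 : exists u, A u != 0.
Proof.
have [u [v uv]] := dim_range_free; exists u; apply/eqP => Au.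
have [|+ _] := uv 1 0; first by rewrite Au scaler0 scale0r addr0.
by move/eqP; rewrite oner_eq0.
Qed.

Lemma normalizeA u : A u != 0 -> exists2 a : R[i], a != 0 & NA (a *: u) = 1.
Proof.
move=> Au; have Nu : NA u != 0.
  by apply: contra_neq Au => /seminormA_eq0.
exists (NA u)^-1%:C; last first.
  by rewrite (seminormZ fAP) cmodR ?invr_ge0 ?seminorm_ge0// mulVf.
by apply: contra_neq Nu => /complexI/eqP; rewrite invr_eq0 => /eqP.
Qed.

Lemma exists_unitA : exists x, NA x = 1.
Proof.
have [u Au] := exists_image_neq0.
by have [a _ au] := normalizeA Au; exists (a *: u).
Qed.

(** Two vectors with independent images under A cannot both be multiples of x
modulo the kernel of A, so one of them has a nonzero A-orthogonal part. *)
Lemma exists_orthogonal_unitA x : NA x = 1 -> exists2 z, NA z = 1 & fA x z = 0.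
Proof.
move=> x1; have [u [v uv]] := dim_range_free.
pose orth w := w - fA w x *: x.
have orthP w : fA x (orth w) = 0.
  rewrite (siBr fAP) (siZr fAP) -(siC fAP) (si_seminorm fAP) x1 expr1n mulr1.
  exact: subrr.
suff [w Aw] : exists w, A (orth w) != 0.
  have [a a0 aw] := normalizeA Aw; exists (a *: orth w) => //.
  by rewrite (siZr fAP) orthP mulr0.
apply: contrapT => /forallNP Aorth.
have Aw w : A w = fA w x *: A x.
  have /negP := Aorth w; rewrite negbK linearB linearZ/= subr_eq0.
  by move/eqP.
have [|v0 _] := uv (fA v x) (- fA u x).
  by rewrite (Aw u) (Aw v) !scalerA -scalerDl mulNr mulrC subrr scale0r.
have Av : A v = 0 by rewrite Aw v0 scale0r.
have [|_ /eqP] := uv 0 1; first by rewrite Av scaler0 scale0r addr0.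
by rewrite oner_eq0.
Qed.

(** * Comparison of the suprema *)

Local Open Scope ereal_scope.

Section Radius.
Variable q : R[i].
Hypothesis q_le1 : (cmod q <= 1)%R.

Lemma wq_A_ge (T : {linear H -> H}) x : NA x = 1%R ->
  (cmod q * cmod (fA (T x) x))%:E <= wq_A ip A q T.
Proof.
move=> x1; have [z z1 xz] := exists_orthogonal_unitA x1.
have [y [y1 xy le_y]] := prescribed_product fAP T q_le1 x1 z1 xz.
apply: le_ereal_sup_tmp; exists (cmod (fA (T x) y))%:E; last by rewrite lee_fin.
by exists (fA (T x) y) => //; exists x, y.
Qed.

Lemma wq_A_ge_w_A (T : {linear H -> H}) :
  (cmod q)%:E * w_A ip A T <= wq_A ip A q T.
Proof.
have [x x1] := exists_unitA.
have [q0|q0] := eqVneq (cmod q) 0%R.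
  by have := wq_A_ge T x1; rewrite q0 mul0e mul0r.
have qp : (0 < cmod q)%R by rewrite lt0r q0 cmod_ge0.
rewrite -lee_pdivlMl//; apply: ge_ereal_sup => _ [y y1 <-].
by rewrite lee_pdivlMl// -EFinM; exact: wq_A_ge.
Qed.

Lemma wq_A_le (T : {linear H -> H}) (M : R) :
  (forall x y, NA x = 1 -> NA y = 1 -> cmod (fA (T x) y) <= M)%R ->
  wq_A ip A q T <= M%:E.
Proof.
move=> bM; apply: ge_ereal_sup => _ [_ [x [y [x1 y1 _ ->]]] <-].
by rewrite lee_fin bM.
Qed.

Lemma wq_A_le_opnormA (T : {linear H -> H}) : B_A ip A T ->
  wq_A ip A q T <= opnormA ip A T.
Proof.
move=> T_BA.
have opnorm_ge v : A v != 0%R -> (NA (T (A v)) / NA (A v))%:E <= opnormA ip A T.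
  move=> Av; apply: le_ereal_sup_tmp; eexists; last exact: lexx.
  exists (A v) => //; split; last exact/eqP.
  by apply: subset_closure; exists v.
have opnorm_ge0 : 0 <= opnormA ip A T.
  have [u Au] := exists_image_neq0.
  by rewrite (le_trans _ (opnorm_ge _ Au))// lee_fin divr_ge0 ?seminorm_ge0.
have TA0 v : NA v = 0%R -> NA (T v) = 0%R.
  move=> v0; have [w wP] := B_A_adjoint T_BA (T v).
  apply/eqP; rewrite -sqrf_eq0 (sqr_seminorm fAP) wP (seminorm_eq0_orth fAP)//.
case: (opnormA ip A T) opnorm_ge0 opnorm_ge => [M| |]; last by [].
- rewrite lee_fin => M0 opnorm_ge; apply: wq_A_le.
  apply: extend_range_bound => // v.
  have [Av0|Avn] := eqVneq (NA (A v)) 0%R; first by rewrite Av0 TA0// mulr0.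
  rewrite -ler_pdivrMr ?lt0r ?Avn ?seminorm_ge0// -lee_fin; apply: opnorm_ge.
  by apply: contra_neq Avn => ->; exact: (seminorm0 fAP).
- by move=> *; exact: leey.
Qed.

End Radius.

Lemma w_A_ge (T : {linear H -> H}) u : NA u = 1%R ->
  (cmod (fA (T u) u))%:E <= w_A ip A T.
Proof. by move=> u1; apply: le_ereal_sup_tmp; eexists; [exists u|]. Qed.

Lemma w_A_ge0 (T : {linear H -> H}) : 0 <= w_A ip A T.
Proof.
have [x x1] := exists_unitA.
by rewrite (le_trans _ (w_A_ge T x1))// lee_fin cmod_ge0.
Qed.

Lemma opnormA_le (T : {linear H -> H}) (M : R) : (0 <= M)%R ->
  (forall x y, NA x = 1 -> NA y = 1 -> cmod (fA (T x) y) <= M)%R ->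
  opnormA ip A T <= M%:E.
Proof.
move=> M0 bM; apply: ge_ereal_sup => _ [x _ <-]; rewrite lee_fin.
exact: (seminorm_ratio_bound fAP).
Qed.

Lemma opnormA_le_2w_A (T : {linear H -> H}) :
  opnormA ip A T <= 2%:E * w_A ip A T.
Proof.
have := w_A_ge0 T; have := @w_A_ge T.
case: (w_A ip A T) => [w| |]; last by [].
- rewrite lee_fin => w_ge w0; rewrite -EFinM; apply: opnormA_le.
    by rewrite mulr_ge0.
  by apply: (bilinear_bound fAP) => u /w_ge; rewrite lee_fin.
- by move=> *; rewrite gt0_muley ?leey// lte_fin.
Qed.

Lemma selfadjoint_le_w_A (q : R[i]) (T : {linear H -> H}) : bounded_op T ->
  A_selfadjoint ip A T ->
  wq_A ip A q T <= w_A ip A T /\ opnormA ip A T <= w_A ip A T.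
Proof.
move=> T_bounded T_sa.
have := w_A_ge0 T; have := @w_A_ge T.
case: (w_A ip A T) => [w| |]; last by [].
- rewrite lee_fin => w_ge w0.
  have bw : (forall x y, NA x = 1 -> NA y = 1 -> cmod (fA (T x) y) <= w)%R.
    apply: (symmetric_bound fAP); last exact: A_selfadjoint_sym.
    by move=> u /w_ge; rewrite lee_fin.
  by split; [exact: wq_A_le | exact: opnormA_le].
- by move=> *; rewrite !leey.
Qed.

End Dimension.
End OperatorForm.

Theorem corollary2p3 (R : realType) (H : completeNormedModType R[i])
    (ip : {dot H for Num.conj}) (ip_norm : induces_norm ip)
    (H_sep : separable H) (H_inf : infinite_dimensional H)
    (A : {linear H -> H}) (A_bounded : bounded_op A)
    (A_pos : positive_op ip A) (A_dim : dim_ge 2 (range A))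
    (q : R[i]) (q_disc : `|q| <= 1) :
  [/\ (forall T : {linear H -> H}, B_Ahalf ip A T ->
         ((cmod q)%:E * w_A ip A T <= wq_A ip A q T)%E),
      (forall T : {linear H -> H}, B_A ip A T ->
         ((cmod q / 2)%:E * opnormA ip A T <= wq_A ip A q T)%E /\
         (wq_A ip A q T <= opnormA ip A T)%E)
    & (forall T : {linear H -> H}, B_A ip A T -> A_selfadjoint ip A T ->
         [/\ ((cmod q)%:E * w_A ip A T <= wq_A ip A q T)%E,
             (wq_A ip A q T <= w_A ip A T)%E,
             ((cmod q)%:E * opnormA ip A T <= wq_A ip A q T)%E
           & (wq_A ip A q T <= opnormA ip A T)%E])].
Proof.
have q_le1 : cmod q <= 1 by rewrite -lecR -cmodE.
have part_i (T : {linear H -> H}) :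
    ((cmod q)%:E * w_A ip A T <= wq_A ip A q T)%E.
  exact: wq_A_ge_w_A.
have upper (T : {linear H -> H}) : B_A ip A T ->
    (wq_A ip A q T <= opnormA ip A T)%E.
  exact: wq_A_le_opnormA.
split=> [T _|T T_BA|T T_BA T_sa].
- exact: part_i.
- split; last exact: upper.
  apply: le_trans (part_i T).
  have <- : ((cmod q / 2)%:E * (2%:E * w_A ip A T) = (cmod q)%:E * w_A ip A T)%E.
    by rewrite muleA -EFinM divfK.
  rewrite lee_wpmul2l//; first by rewrite lee_fin divr_ge0// cmod_ge0.
  exact: opnormA_le_2w_A.
- have [wq_le opnorm_le] :=
    selfadjoint_le_w_A ip_norm A_pos A_dim q T_BA.1 T_sa.
  split=> //; last exact: upper.
  apply: le_trans (part_i T); apply: lee_wpmul2l => //.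
  by rewrite lee_fin cmod_ge0.
Qed.
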